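(* Let $h>1$ be an integer, $q=2^h$, and let $U$ be a subset of $\mathrm{GF}(q)^{\star}$ with $|U|<\frac{q}{4}-1$. Let $\Omega$ be a regular hyperoval of $AG(2,q^2)$. Then $\Omega^{\star}=\Omega\cap\Phi$ is a complete arc in the projective closure $\overline{\mathcal M_U(q^2)}$, i.e. no three points of $\Omega^{\star}$ lie on a common line of $\overline{\mathcal M_U(q^2)}$, and no point of $\overline{\mathcal M_U(q^2)}$ outside $\Omega^{\star}$ can be added to $\Omega^{\star}$ so that the resulting set still has no three points on a common line of $\overline{\mathcal M_U(q^2)}$.
   Context: For a prime power $q$, the norm is $\|x\|=x^{q+1}$ for $x\in\mathrm{GF}(q^2)$, so $\|x\|\in\mathrm{GF}(q)$. For a proper subset $U$ of $\mathrm{GF}(q)^{\star}=\mathrm{GF}(q)\setminus\{0\}$, define on $\mathrm{GF}(q^2)$ the product $a\odot b=ab$ if $\|b\|\notin U$ and $a\odot b=a^q b$ if $\|b\|\in U$. The affine plane $\mathcal M_U(q^2)$ (the dual of an André plane) has as points the points $P(x,y)$, $x,y\in\mathrm{GF}(q^2)$, of $AG(2,q^2)$, and as lines the sets $[c]=\{P(x,y): x=c\}$ for $c\in\mathrm{GF}(q^2)$ and $[m,n]=\{P(x,y): y=m\odot x+n\}$ for $m,n\in\mathrm{GF}(q^2)$. Its projective closure $\overline{\mathcal M_U(q^2)}$ is obtained in the usual way by adding one point at infinity for each parallel class of lines (the lines $[m,n]$ with fixed $m$ form one class; the lines $[c]$ form another) and a line at infinity consisting of these points. Set $\Phi=\{P(x,y):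 \|x\|\notin U\}$ and $\Psi=\{P(x,y):\|x\|\in U\}$. For $q$ even, a regular hyperoval of $PG(2,q^2)$ is the union of a non-degenerate conic and its nucleus; a regular hyperoval of $AG(2,q^2)$ is a regular hyperoval of $PG(2,q^2)$ all of whose $q^2+2$ points are affine points. An arc is a set of points no three of which are collinear; it is complete if it is not contained in a strictly larger arc. *)

(* Defs.v *)
From HB Require Import structures.
From mathcomp Require Import all_boot all_order all_algebra all_field.
Set Implicit Arguments. Unset Strict Implicit. Unset Printing Implicit Defensive.
Import GRing.Theory.
Local Open Scope ring_scope.

Section Plane.
Variable F : finFieldType.   (* plays the role of GF(q^2) *)
Variable q : nat.            (* q = 2^h *)

Definition norm (x : F) : F := x ^+ q.+1.

Definition odot (U : {set F}) (a b : F) : F :=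
  if norm b \in U then a ^+ q * b else a * b.

Inductive mpoint : Type :=
  | Aff of F & F
  | InfSlope of F    (* point at infinity of the parallel class {[m,n] : n} *)
  | InfVert.         (* point at infinity of the parallel class {[c] : c} *)

Inductive mline : Type :=
  | LVert of F
  | LSlope of F & F
  | LInf.

Definition incid (U : {set F}) (P : mpoint) (l : mline) : Prop :=
  match P, l with
  | Aff x y, LVert c => x = c
  | Aff x y, LSlope m n => y = odot U m x + n
  | Aff _ _, LInf => False
  | InfSlope m, LSlope m' _ => m = m'
  | InfSlope _, LVert _ => False
  | InfSlope _, LInf => True
  | InfVert, LVert _ => True
  | InfVert, LSlope _ _ => False
  | InfVert, LInf => True
  end.

Definition is_arc (U : {set F}) (S : mpoint -> Prop) : Prop :=
  forall P1 P2 P3, S P1 -> S P2 -> S P3 ->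
    P1 <> P2 -> P1 <> P3 -> P2 <> P3 ->
    ~ (exists l, incid U P1 l /\ incid U P2 l /\ incid U P3 l).

Definition is_complete_arc (U : {set F}) (S : mpoint -> Prop) : Prop :=
  is_arc U S /\
  forall P, ~ S P -> ~ is_arc U (fun X => S X \/ X = P).

Definition qform (a b c d e f : F) (v : F * F * F) : F :=
  let: (x, y, z) := v in
  a * x ^+ 2 + b * y ^+ 2 + c * z ^+ 2 + d * x * y + e * x * z + f * y * z.

Definition vadd (v w : F * F * F) : F * F * F :=
  (v.1.1 + w.1.1, v.1.2 + w.1.2, v.2 + w.2).

Definition polar (a b c d e f : F) (v w : F * F * F) : F :=
  qform a b c d e f (vadd v w) - qform a b c d e f v - qform a b c d e f w.

Definition nondeg_qform (a b c d e f : F) : Prop :=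
  forall v : F * F * F, v <> (0, 0, 0) ->
    ~ (qform a b c d e f v = 0 /\ forall w, polar a b c d e f v w = 0).

Definition nucleus_vec (a b c d e f : F) (n : F * F * F) : Prop :=
  n <> (0, 0, 0) /\ forall w, polar a b c d e f n w = 0.

(* Om (a set of affine points P(x,y), identified with (x,y,1)) is a regular
   hyperoval of AG(2,F): the union of a non-degenerate conic of PG(2,F) and
   its nucleus, all of whose points are affine. *)
Definition regular_affine_hyperoval (Om : {set F * F}) : Prop :=
  exists a b c d e f : F, exists n : F * F * F,
    [/\ nondeg_qform a b c d e f,
        nucleus_vec a b c d e f n,
        (forall x y : F, (x, y) <> (0, 0) -> qform a b c d e f (x, y, 0) <> 0),
        n.2 <> 0 &
        Om = [set p : F * F | qform a b c d e f (p.1, p.2, 1) == 0]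
             :|: [set (n.1.1 / n.2, n.1.2 / n.2)]].
End Plane.

(* Main.v *)
(** Put q = 2^h and call a point of the hyperoval outer or inner according to
whether it lies in Phi or in Psi. Vertical lines meet the hyperoval at most twice,
so there are at most 2(q+1)|U| <= (q-8)(q+1)/2 inner points among at least q^2.
On Phi the lines of the plane are those of AG(2,q^2), and every line of AG(2,q^2)
meets the hyperoval in 0 or 2 points. For a point P of Phi off the hyperoval, or
at infinity, if no line through P contained two outer points then sending an outer
point to the second hyperoval point on its line through P would be an injection
from the outer to the inner points, which are too few.

Let P = (x0, y0) be in Psi. The lines through P restrict on Phi to the lines
y = m x - m^q x0 + y0, the non-vertical lines of a Baer subplane B. An outer point
is on exactly one of them, so if no two outer points shared one, the second point
on it would always be inner. An inner point off B is on at most one such line and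
a point of B on at most q, so again a contradiction arises as soon as at most 6
hyperoval points lie in B. Otherwise at least 5 points of the conic are fixed by
the Baer involution of B; since conics meet in at most 4 points, the involution
preserves the conic. It also fixes the lines y = m x - m^q x0 + y0, so such a line
through an outer conic point and a point of B would carry three hyperoval points.
The only exceptions are hyperoval points on the vertical line through the nucleus,
kept apart so that slopes from the nucleus parametrize the rest of the conic. *)

Require Import Defs.
From HB Require Import structures.
From mathcomp Require Import all_boot all_order all_algebra all_field.
From mathcomp Require Import ring zify.
Import GRing.Theory.
Local Open Scope ring_scope.

(** * Equational device and counting bounds *)

(** Lets [ring] check an equality whose difference is an explicit combination [z] of known
    equations. *)
Lemma eq_from_sub (R : zmodType) (x y z : R) : z = 0 -> x - y = z -> x = y.
Proof. by move=> -> /eqP; rewrite subr_eq0 => /eqP. Qed.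

(** The fibres over [B] cover [A]. With [k = 1] this replaces an injection whose values are only
    known to exist. *)
Lemma card_le_rel (S T : finType) (A : {set S}) (B : {set T})
    (R : S -> T -> bool) (k : nat) :
  (forall x, x \in A -> exists2 y, y \in B & R x y) ->
  (forall y, y \in B -> #|[set x in A | R x y]| <= k)%N ->
  (#|A| <= k * #|B|)%N.
Proof.
move=> AB Bk.
have sub : A \subset \bigcup_(y in B) [set x in A | R x y].
  apply/subsetP => x xA; have [y yB Rxy] := AB x xA.
  by apply/bigcupP; exists y => //; rewrite inE xA.
apply: leq_trans (subset_leq_card sub) _.
apply: (@leq_trans (\sum_(y in B) #|[set x in A | R x y]|)).
  apply: (big_ind2 (fun (C : {set S}) m => #|C| <= m)%N) => [|C m D n leC leD|//].
    by rewrite cards0.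
  exact: leq_trans (leq_card_setU C D).1 (leq_add leC leD).
by rewrite mulnC -sum_nat_const; apply: leq_sum.
Qed.

Lemma card_set_le1 (T : finType) (A : {set T}) :
  (forall x y, x \in A -> y \in A -> x = y) -> (#|A| <= 1)%N.
Proof. by move=> A1; apply/card_le1_eqP => x y xA yA; apply: A1. Qed.

Lemma card_roots_le (R : finFieldType) (p : {poly R}) (A : {set R}) (k : nat) :
  p != 0 -> (size p <= k.+1)%N -> (forall x, x \in A -> root p x) ->
  (#|A| <= k)%N.
Proof.
move=> p0 pk pA; rewrite cardE -ltnS; apply: leq_trans pk.
apply: max_poly_roots => //; last exact: enum_uniq.
by apply/allP => x; rewrite mem_enum; apply: pA.
Qed.

(** * Hyperovals in characteristic 2 with the nucleus at the origin *)

Section Hyperoval.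
Variables (F : finFieldType) (a b d : F).
Hypothesis two0 : 2%:R = 0 :> F.
Hypothesis d_neq0 : d != 0.

(** With the nucleus at the origin the conic is [cform X Y = 1]: no linear terms remain. Anisotropy
    means that it has no points at infinity. *)
Definition cform (X Y : F) : F := a * X ^+ 2 + d * X * Y + b * Y ^+ 2.

Hypothesis aniso : forall X Y, cform X Y = 0 -> X = 0 /\ Y = 0.

Definition on_oval (X Y : F) : bool := (X == 0) && (Y == 0) || (cform X Y == 1).

Lemma char2_eq (x y z : F) : x - y = 2%:R * z -> x = y.
Proof. by apply: eq_from_sub; rewrite two0 mul0r. Qed.

Lemma char2_sqr_inj (x y : F) : x ^+ 2 = y ^+ 2 -> x = y.
Proof.
move=> /eqP; rewrite eqf_sqr => /orP[/eqP //|/eqP ->].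
by apply: (char2_eq _ _ (- y)); ring.
Qed.

Lemma char2_sqrt (x : F) : exists y, y ^+ 2 = x.
Proof.
have [g _ gK] := injF_bij (char2_sqr_inj).
by exists (g x).
Qed.

Lemma cformZ t X Y : cform (t * X) (t * Y) = t ^+ 2 * cform X Y.
Proof. by rewrite /cform; ring. Qed.

Lemma cform00 : cform 0 0 = 0.
Proof. by rewrite /cform; ring. Qed.

(** In characteristic 2 the polar form is alternating, so the coefficient of [t] is a multiple of a
    determinant, zero when the line passes through the nucleus. *)
Lemma cform_line X Y t v w :
  cform (X + t * v) (Y + t * w) =
  cform X Y + t * (d * (X * w - Y * v)) + t ^+ 2 * cform v w.
Proof.
apply: (char2_eq _ _ (t * (a * X * v + b * Y * w + d * Y * v))).
by rewrite /cform; ring.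
Qed.

Lemma cform_unit_sqrt v w : v != 0 \/ w != 0 -> exists t, t ^+ 2 * cform v w = 1.
Proof.
move=> vw; have [t tE] := char2_sqrt (cform v w)^-1.
exists t; rewrite tE mulVf //; apply/eqP => /aniso[v0 w0].
by case: vw; rewrite ?v0 ?w0 eqxx.
Qed.

Lemma oval_mate X Y v w : on_oval X Y -> v != 0 \/ w != 0 ->
  exists2 t, t != 0 & on_oval (X + t * v) (Y + t * w).
Proof.
move=> O vw; have [r rE] := cform_unit_sqrt _ _ vw.
have r0 : r != 0.
  by apply/eqP => r0; move: rE => /eqP; rewrite r0 expr0n mul0r eq_sym oner_eq0.
case/orP: O => [/andP[/eqP-> /eqP->]|/eqP O].
  by exists r => //; rewrite /on_oval !add0r cformZ rE eqxx orbT.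
have g0 : cform v w != 0.
  by apply/eqP => g0; move: rE => /eqP; rewrite g0 mulr0 eq_sym oner_eq0.
(* A zero determinant puts the nucleus on the line, and the nucleus is the mate. *)
have [e0|e0] := eqVneq (X * w - Y * v) 0.
  have [v0|v0] := eqVneq v 0.
    have w0 : w != 0 by case: vw => //; rewrite v0 eqxx.
    have X0 : X = 0.
      by move: e0 => /eqP; rewrite v0 mulr0 subr0 mulf_eq0 (negPf w0) orbF => /eqP.
    exists (- Y / w); last by rewrite /on_oval X0 v0 mulr0 addr0 divfK // subrr eqxx.
    rewrite mulf_neq0 ?invr_neq0 // oppr_eq0; apply/eqP => Y0.
    by move: O => /eqP; rewrite X0 Y0 cform00 eq_sym oner_eq0.
  have YE : Y = X / v * w.
    apply: (mulIf v0); rewrite mulrAC divfK //; apply/eqP.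
    by rewrite eq_sym -subr_eq0 e0.
  exists (- (X / v)).
    rewrite oppr_eq0; apply/eqP => z0; move: O => /eqP.
    have X0 : X = 0 by rewrite -(divfK v0 X) z0 mul0r.
    by rewrite YE X0 !mul0r cform00 eq_sym oner_eq0.
  by rewrite /on_oval mulNr divfK // mulNr -YE !subrr eqxx.
(* The nonzero root of the quadratic in [t] given by [cform_line]. *)
exists (- (d * (X * w - Y * v) / cform v w)).
  by rewrite oppr_eq0 !mulf_neq0 // invr_neq0.
rewrite /on_oval cform_line O; apply/orP; right; apply/eqP.
by field.
Qed.

Lemma oval_line X Y v w t s : t != 0 -> s != 0 ->
  on_oval X Y -> on_oval (X + t * v) (Y + t * w) ->
  on_oval (X + s * v) (Y + s * w) -> v != 0 \/ w != 0 -> t = s.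
Proof.
have aux X' Y' r g e : cform X' Y' = 1 ->
    (cform X' Y' + r * e + r ^+ 2 * g == 1) = (r == 0) || (r * g + e == 0).
  move=> ->; rewrite -mulf_eq0 -subr_eq0; congr (_ == 0); ring.
move=> t0 s0 O Ot Os vw; case/orP: O => [/andP[/eqP X0 /eqP Y0]|/eqP O].
  move: Ot Os; rewrite X0 Y0 !add0r /on_oval !mulf_eq0 (negPf t0) (negPf s0) /=.
  case: (boolP ((v == 0) && (w == 0))) => [/andP[/eqP v0 /eqP w0]|_ /=].
    by case: vw; rewrite ?v0 ?w0 eqxx.
  rewrite !cformZ => /eqP Ot /eqP Os; apply: char2_sqr_inj.
  have g0 : cform v w != 0.
    by apply/eqP => g0; move: Ot => /eqP; rewrite g0 mulr0 eq_sym oner_eq0.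
  by apply: (mulIf g0); rewrite Ot Os.
have g0 : cform v w != 0.
  apply/eqP => /aniso[v0 w0]; case: vw; by rewrite ?v0 ?w0 eqxx.
move: Ot Os; rewrite /on_oval !cform_line !aux // (negPf t0) (negPf s0) /=.
set e := d * _.
(* If the nucleus is on the line then [e = 0], and by [off] the line has no second conic point. *)
have center r : (X + r * v == 0) && (Y + r * w == 0) -> e = 0.
  move=> /andP[/eqP Xr /eqP Yr]; rewrite /e.
  apply: (eq_from_sub _ _ _ (d * ((X + r * v) * w - (Y + r * w) * v))).
    by rewrite Xr Yr !mul0r subrr mulr0.
  by ring.
have off r : r != 0 -> e = 0 -> (r * cform v w + e == 0) = false.
  by move=> r0 ->; rewrite addr0 mulf_eq0 (negPf r0) (negPf g0).
case/orP=> [Ct|Et]; case/orP=> [Cs|Es].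
- have [/eqP Xt /eqP Yt] := andP Ct; have [/eqP Xs /eqP Ys] := andP Cs.
  have Xts : (t - s) * v = 0.
    by rewrite -(subrr 0) -{1}Xt -Xs; ring.
  have Yts : (t - s) * w = 0.
    by rewrite -(subrr 0) -{1}Yt -Ys; ring.
  apply/eqP; rewrite -subr_eq0; apply/negPn/negP => ts; case: vw => /negP; apply.
    by move/eqP: Xts; rewrite mulf_eq0 (negPf ts).
  by move/eqP: Yts; rewrite mulf_eq0 (negPf ts).
- by move: Es; rewrite off // (center t).
- by move: Et; rewrite off // (center s).
apply: (mulIf g0); apply: (addIr e).
by rewrite (eqP Et) (eqP Es).
Qed.

Definition oval (n1 n2 : F) : {set F * F} :=
  [set p | on_oval (p.1 - n1) (p.2 - n2)].

Definition aligned (v w : F) (p r : F * F) : bool :=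
  w * (r.1 - p.1) == v * (r.2 - p.2).

Lemma alignedP v w p r : v != 0 \/ w != 0 -> aligned v w p r ->
  exists t, r = (p.1 + t * v, p.2 + t * w).
Proof.
case: p r => [x y] [x' y']; rewrite /aligned /= => vw /eqP e.
have [v0|v0] := eqVneq v 0.
  have w0 : w != 0 by case: vw => //; rewrite v0 eqxx.
  move: e => /eqP; rewrite v0 mul0r mulf_eq0 (negPf w0) subr_eq0 /= => /eqP ->.
  by exists ((y' - y) / w); rewrite mulr0 addr0 divfK // subrKC.
exists ((x' - x) / v); rewrite divfK // subrKC.
rewrite mulrAC [_ * w]mulrC e [v * _]mulrC mulfK // subrKC //.
Qed.

Lemma oval_aligned_mate n1 n2 (v w : F) p : p \in oval n1 n2 -> v != 0 \/ w != 0 ->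
  exists r, [/\ r \in oval n1 n2, r != p & aligned v w p r].
Proof.
rewrite inE => Op vw; have [t t0 Ot] := oval_mate _ _ _ _ Op vw.
exists (p.1 + t * v, p.2 + t * w); split => /=.
- by rewrite inE /= ![_ + t * _ - _]addrAC.
- apply/eqP => /(congr1 (fun r => (r.1 - p.1, r.2 - p.2))) /=.
  rewrite ![_ + t * _ - _]addrAC !subrr !add0r => -[tv tw].
  by case: vw => /negP; apply; [move/eqP: tv|move/eqP: tw];
    rewrite mulf_eq0 (negPf t0).
by rewrite /aligned /=; apply/eqP; ring.
Qed.

Lemma oval_aligned_uniq n1 n2 (v w : F) p r s : v != 0 \/ w != 0 ->
  p \in oval n1 n2 -> r \in oval n1 n2 -> s \in oval n1 n2 ->
  r != p -> s != p -> aligned v w p r -> aligned v w p s -> r = s.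
Proof.
move=> vw Op Or Os rp sp /(alignedP _ _ _ _ vw)[t rE] /(alignedP _ _ _ _ vw)[u sE].
move: Op Or Os; rewrite !inE rE sE /= ![_ + _ * _ - _]addrAC => Op Or Os.
have nz k : (p.1 + k * v, p.2 + k * w) != p -> k != 0.
  by apply: contraNneq => ->; rewrite !mul0r !addr0 -surjective_pairing.
rewrite rE in rp; rewrite sE in sp.
by rewrite (oval_line _ _ _ _ _ _ (nz _ rp) (nz _ sp) Op Or Os vw).
Qed.

Lemma card_oval_vertical n1 n2 x : (#|[set p in oval n1 n2 | p.1 == x]| <= 2)%N.
Proof.
rewrite leqNgt; apply/negP => /card_gt2P[p [r [s [[]]]]].
rewrite !inE => /andP[Op /eqP px] /andP[Or /eqP rx] /andP[Os /eqP sx].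
rewrite [p == r]eq_sym => -[rp rs sp].
case/eqP: rs; apply: (oval_aligned_uniq n1 n2 0 1 p);
  rewrite ?inE ?oner_eq0 //; first by right.
- by rewrite /aligned px rx !subrr mulr0 mul0r eqxx.
- by rewrite /aligned px sx !subrr mulr0 mul0r eqxx.
Qed.

(** Each slope [s] yields a conic point on the line of slope [s] through the nucleus, and that point
    determines [s]. *)
Lemma card_oval n1 n2 : (#|F| <= #|oval n1 n2|)%N.
Proof.
rewrite -cardsT -[leqRHS]mul1n.
apply: (@card_le_rel _ _ [set: F] (oval n1 n2)
  (fun s p => (p.1 != n1) && (p.2 - n2 == s * (p.1 - n1)))) => [s _|p _].
  have vw : 1 != 0 :> F \/ s != 0 by left; exact: oner_neq0.
  have [t tE] := cform_unit_sqrt _ _ vw.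
  have t0 : t != 0.
    by apply/eqP => t0; move: tE => /eqP; rewrite t0 expr0n mul0r eq_sym oner_eq0.
  exists (t + n1, t * s + n2) => /=.
    rewrite inE /= !addrK /on_oval.
    by rewrite -[X in cform X]mulr1 cformZ tE eqxx orbT.
  by rewrite -subr_eq0 !addrK t0 mulrC eqxx.
apply: card_set_le1 => s1 s2. rewrite !inE /=.
move=> /andP[pn /eqP ps] /andP[_ /eqP ps'].
by apply: (@mulIf _ (p.1 - n1)); rewrite ?subr_eq0 // -ps -ps'.
Qed.

Lemma char2_sqrD (x y : F) : (x + y) ^+ 2 = x ^+ 2 + y ^+ 2.
Proof. by apply: (char2_eq _ _ (x * y)); ring. Qed.

(* On [cform X Y = 1] the square of a quadratic polynomial in [X], [Y] is
   [X ^+ 4] times a quartic in the slope [Y / X], as odd terms disappear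
   in characteristic 2. *)
Lemma conic_quadric_square (al be ga de ep ze X Y : F) :
  X != 0 -> cform X Y = 1 ->
  (al * X ^+ 2 + be * Y ^+ 2 + ga + de * X * Y + ep * X + ze * Y) ^+ 2 =
  X ^+ 4 * (Poly [:: al ^+ 2 + ga ^+ 2 * a ^+ 2 + ep ^+ 2 * a; ep ^+ 2 * d;
    ga ^+ 2 * d ^+ 2 + de ^+ 2 + ep ^+ 2 * b + ze ^+ 2 * a; ze ^+ 2 * d;
    be ^+ 2 + ga ^+ 2 * b ^+ 2 + ze ^+ 2 * b]).[Y / X].
Proof.
move=> X0; set s := Y / X; have -> : Y = s * X by rewrite divfK.
move: s => s.
rewrite /cform => C; rewrite !char2_sqrD !exprMn.
have {}C : X ^+ 2 * (a + d * s + b * s ^+ 2) = 1 by rewrite -C; ring.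
have C2 : X ^+ 4 * (a ^+ 2 + d ^+ 2 * s ^+ 2 + b ^+ 2 * s ^+ 4) = 1.
  rewrite -[RHS](expr1n _ 2) -[in RHS]C [in RHS]exprMn !char2_sqrD !exprMn; ring.
rewrite horner_Poly /=.
(* The two sides differ by multiples of the conic equation and of its square. *)
apply: (eq_from_sub _ _ _ (ga ^+ 2 *
    (1 - X ^+ 4 * (a ^+ 2 + d ^+ 2 * s ^+ 2 + b ^+ 2 * s ^+ 4)) +
  (ep ^+ 2 + ze ^+ 2 * s ^+ 2) * X ^+ 2 *
    (1 - X ^+ 2 * (a + d * s + b * s ^+ 2)))).
  by rewrite C C2 !subrr !mulr0 addr0.
by ring.
Qed.

(** The quartic of [conic_quadric_square] has more than four roots, hence is zero. Distinct points
    of [A] have distinct slopes, as square roots are unique in characteristic 2. *)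
Lemma conic_quadric_vanish (al be ga de ep ze : F) (A : {set F * F}) :
  (4 < #|A|)%N ->
  let E X Y := al * X ^+ 2 + be * Y ^+ 2 + ga + de * X * Y + ep * X + ze * Y in
  (forall p, p \in A -> [/\ p.1 != 0, cform p.1 p.2 = 1 & E p.1 p.2 = 0]) ->
  forall X Y, X != 0 -> cform X Y = 1 -> E X Y = 0.
Proof.
move=> A4 E AE X Y X0 CXY.
have EP := conic_quadric_square al be ga de ep ze.
set P := Poly _ in EP.
have [P0|P0] := eqVneq P 0.
  by apply/eqP; rewrite -sqrf_eq0 /E EP // P0 horner0 mulr0.
suff : (#|A| <= 4)%N by rewrite leqNgt A4.
rewrite -(@card_in_imset _ _ (fun p => p.2 / p.1)).
  apply: (@card_roots_le _ P) => // [|x /imsetP[p pA ->]].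
    exact: leq_trans (size_Poly _) _.
  have [p0 Cp /eqP Ep] := AE _ pA; move: Ep.
  rewrite -sqrf_eq0 /E EP // mulf_eq0 expf_eq0 (negPf p0) /=.
  by rewrite rootE.
move=> [x y] [x' y'] pA rA /= s.
have /= [x0 C _] := AE _ pA; have /= [x'0 C' _] := AE _ rA.
have yE : y = x * (y / x) by rewrite mulrC divfK.
have y'E : y' = x' * (y / x) by rewrite s mulrC divfK.
have xx : x = x'.
  move: C C'; rewrite yE y'E -{1}[x]mulr1 -{1}[x']mulr1 !cformZ => C C'.
  have g0 : cform 1 (y / x) != 0.
    by apply/eqP => g0; move: C => /eqP; rewrite g0 mulr0 eq_sym oner_eq0.
  by apply: char2_sqr_inj; apply: (mulIf g0); rewrite C C'.
by rewrite yE y'E xx.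
Qed.

End Hyperoval.

(** * Outer and inner points; lines through points of Phi or at infinity *)

Section DualAndre.
Variables (F : finFieldType) (h : nat) (U : {set F}) (a b d n1 n2 : F).
Local Notation q := (2 ^ h)%N.
Local Notation norm := (norm q).
Hypothesis h_gt1 : (1 < h)%N.
Hypothesis cardF : #|F| = (q ^ 2)%N.
Hypothesis U_sub : forall u, u \in U -> u != 0 /\ u ^+ q = u.
Hypothesis U_small : (4 * (#|U| + 1) < q)%N.
Hypothesis d_neq0 : d != 0.
Hypothesis aniso : forall X Y, cform F a b d X Y = 0 -> X = 0 /\ Y = 0.
Local Notation cform := (cform F a b d).
Local Notation oval := (oval F a b d n1 n2).
Local Notation aligned := (aligned F).

Lemma pchar2 : 2%N \in [pchar F].
Proof. by apply: (@card_finPcharP _ _ (h * 2)) => //; rewrite expnM. Qed.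

Lemma char2_two0 : 2%:R = 0 :> F.
Proof. exact: pcharf0 pchar2. Qed.

Lemma frobD (x y : F) : (x + y) ^+ q = x ^+ q + y ^+ q.
Proof. by apply/exprDn_pchar; rewrite pnatX (pi_pnat _ pchar2). Qed.

Lemma frobB (x y : F) : (x - y) ^+ q = x ^+ q - y ^+ q.
Proof. by apply/eqP; rewrite eq_sym subr_eq -frobD subrK. Qed.

Lemma frobX (x : F) n : (x ^+ n) ^+ q = (x ^+ q) ^+ n.
Proof. exact: exprAC. Qed.

Lemma frobK (x : F) : (x ^+ q) ^+ q = x.
Proof. by rewrite -exprM mulnn -cardF expf_card. Qed.

Lemma frob_inj (x y : F) : x ^+ q = y ^+ q -> x = y.
Proof. by move=> e; rewrite -(frobK x) e frobK. Qed.

Lemma normE (x : F) : norm x = x * x ^+ q.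
Proof. exact: exprS. Qed.

Lemma normM (x y : F) : norm (x * y) = norm x * norm y.
Proof. exact: exprMn. Qed.

Lemma norm_frob (x : F) : norm (x ^+ q) = norm x.
Proof. by rewrite !normE frobK mulrC. Qed.

Lemma frob_norm (x : F) : norm x ^+ q = norm x.
Proof. by rewrite !normE exprMn frobK mulrC. Qed.

Lemma norm_eq0 (x : F) : (norm x == 0) = (x == 0).
Proof. by rewrite /Defs.norm expf_eq0. Qed.

Lemma norm_inU_neq0 (x : F) : norm x \in U -> x != 0.
Proof. by move/U_sub=> [+ _]; rewrite norm_eq0. Qed.

Definition inner : {set F * F} := [set p in oval | norm p.1 \in U].
Definition outer : {set F * F} := [set p in oval | norm p.1 \notin U].

Lemma in_inner p : (p \in inner) = (p \in oval) && (norm p.1 \in U).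
Proof. by rewrite !inE. Qed.

Lemma in_outer p : (p \in outer) = (p \in oval) && (norm p.1 \notin U).
Proof. by rewrite !inE. Qed.

Lemma card_inner_outer : (#|inner| + #|outer| = #|oval|)%N.
Proof.
rewrite -(cardsID [set p | norm p.1 \in U] oval); congr addn.
  by apply: eq_card => p; rewrite !inE.
by apply: eq_card => p; rewrite !inE andbC.
Qed.

Lemma card_norm_fiber (u : F) : (#|[set x : F | norm x == u]| <= q.+1)%N.
Proof.
apply: (@card_roots_le _ ('X^(q.+1) - u%:P)).
- by rewrite -size_poly_eq0 size_XnsubC.
- by rewrite size_XnsubC.
by move=> x; rewrite inE rootE !hornerE subr_eq0.
Qed.

Lemma card_inner : (#|inner| <= 2 * (q.+1 * #|U|))%N.
Proof.
apply: (@leq_trans (2 * #|[set x : F | norm x \in U]|)).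
  apply: (@card_le_rel _ _ _ _ (fun p x => p.1 == x)) => [p|x _].
    by rewrite !inE => /andP[_ pU]; exists p.1; rewrite ?inE.
  apply: leq_trans (card_oval_vertical _ _ _ _ char2_two0 aniso n1 n2 x).
  apply: subset_leq_card; apply/subsetP => p; rewrite !inE.
  by move=> /andP[/andP[-> _] ->].
rewrite leq_mul2l /=.
apply: (@card_le_rel _ _ _ _ (fun x u => norm x == u)) => [x|u _].
  by rewrite inE => xU; exists (norm x).
apply: leq_trans (card_norm_fiber u); apply: subset_leq_card.
by apply/subsetP => x; rewrite !inE => /andP[_ ->].
Qed.

Lemma card_inner_small : (2 * #|inner| + 7 * q + 8 <= q ^ 2)%N.
Proof.
(* As 4 divides [q], [U_small] sharpens to 4|U| <= q - 8, and (q + 1)(q - 8) = q^2 - 7q - 8. *)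
have [r qE] : exists r, q = (4 * r)%N.
  by exists (2 ^ (h - 2))%N; rewrite -(expnD 2 2) subnKC.
have := card_inner; have := U_small; rewrite qE; nia.
Qed.

Lemma card_oval_ge : (q ^ 2 <= #|oval|)%N.
Proof. by rewrite -cardF; apply: card_oval char2_two0 aniso n1 n2. Qed.

Let oval_mate := oval_aligned_mate _ _ _ _ char2_two0 d_neq0 aniso n1 n2.
Let oval_uniq := oval_aligned_uniq _ _ _ _ char2_two0 aniso n1 n2.

(* A point of the projective plane has homogeneous coordinates [(px, py, pz)];
   [(px - pz * r.1, py - pz * r.2)] is the direction of the line joining it to [r]. *)
Lemma aligned_join_sym (px py pz : F) r s :
  aligned (px - pz * r.1) (py - pz * r.2) r s ->
  aligned (px - pz * s.1) (py - pz * s.2) s r.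
Proof.
rewrite /aligned => /eqP e; rewrite -subr_eq0; apply/eqP.
apply: (eq_from_sub _ _ _ ((px - pz * r.1) * (s.2 - r.2) -
  (py - pz * r.2) * (s.1 - r.1))); first by rewrite e subrr.
by ring.
Qed.

(** Treats affine points ([pz = 1]) and points at infinity ([pz = 0]) together; the hypothesis says
    that the point is not on the hyperoval. *)
Lemma outer_secant (px py pz : F) :
  (forall r, r \in oval -> px - pz * r.1 != 0 \/ py - pz * r.2 != 0) ->
  exists r s, [/\ r \in outer, s \in outer, r != s &
    aligned (px - pz * r.1) (py - pz * r.2) r s].
Proof.
move=> off.
pose R r s := (s != r) && aligned (px - pz * r.1) (py - pz * r.2) r s.
have [/exists_inP[r ro /exists_inP[s so /andP[sr rs]]]|] :=
    boolP [exists r in outer, exists s in outer, R r s].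
  by exists r, s; split => //; rewrite eq_sym.
move=> /exists_inPn none.
suff : (#|outer| <= 1 * #|inner|)%N.
  have := card_inner_outer; have := card_oval_ge; have := card_inner_small; lia.
apply: (@card_le_rel _ _ _ _ R) => [r ro|s].
  have rO : r \in oval by move: ro; rewrite in_outer => /andP[].
  have [s [sO sr rs]] := oval_mate _ _ _ rO (off _ rO).
  have Rrs : R r s by rewrite /R sr.
  exists s => //; rewrite in_inner sO /=; apply: contraT => sU.
  by have /exists_inP[] := none _ ro; exists s => //; rewrite in_outer sO.
rewrite in_inner => /andP[sO _]; apply: card_set_le1 => r r'.
rewrite inE [r' \in _]inE !in_outer => /andP[/andP[rO _] /andP[sr /aligned_join_sym rs]].
move=> /andP[/andP[r'O _] /andP[sr' /aligned_join_sym r's]].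
by apply: (oval_uniq _ _ s _ _ (off _ sO)) => //; rewrite eq_sym.
Qed.

(** * Lines through a point of Psi and the Baer involution *)

Section InnerPoint.
Variables x0 y0 : F.
Hypothesis x0U : norm x0 \in U.

(* The points of [Phi] on the line of slope [m] of the plane through [(x0, y0)]
   satisfy this classical equation. *)
Definition on_line (m : F) (p : F * F) : bool :=
  p.2 - y0 == m * p.1 - m ^+ q * x0.

(** Cramer's rule for [m] in the system formed by the equation of [on_line] and its [q]-th power,
    with unknowns [m] and [m ^+ q]. *)
Definition line_slope (p : F * F) : F :=
  (p.1 ^+ q * (p.2 - y0) + x0 * (p.2 - y0) ^+ q) / (norm p.1 - norm x0).

Lemma x0_neq0 : x0 != 0. Proof. exact: norm_inU_neq0. Qed.

Lemma on_line_slope p : norm p.1 != norm x0 -> on_line (line_slope p) p.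
Proof.
rewrite -subr_eq0 /on_line /line_slope => D0.
set D := _ - norm x0 in D0 *; set w := p.2 - y0.
have Dq : D ^+ q = D by rewrite /D frobB !frob_norm.
have DE : D = p.1 * p.1 ^+ q - x0 * x0 ^+ q by rewrite /D !normE.
move: D w D0 Dq DE => D w D0 Dq DE.
rewrite !exprMn exprVn Dq frobD !exprMn !frobK; apply/eqP.
apply: (mulIf D0); rewrite mulrBl mulrAC divfK // [_ / _ * x0]mulrAC divfK //.
by rewrite DE; ring.
Qed.

(** Subtracting the equations and taking norms gives the first conclusion. Together the two
    conclusions say that [p] lies in the Baer subplane. *)
Lemma on_line_inj m m' p : on_line m p -> on_line m' p -> m != m' ->
  norm p.1 = norm x0 /\ x0 * (p.2 - y0) ^+ q = - (p.1 ^+ q * (p.2 - y0)).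
Proof.
rewrite /on_line => /eqP e /eqP e'; rewrite -subr_eq0 => mm.
have em : (m - m') * p.1 = (m - m') ^+ q * x0.
  apply/eqP; rewrite -subr_eq0 frobB; apply/eqP.
  apply: (eq_from_sub _ _ _ ((p.2 - y0) - (p.2 - y0))); first exact: subrr.
  by rewrite {1}e e'; ring.
have np : norm p.1 = norm x0.
  have nm : norm (m - m') != 0 by rewrite norm_eq0.
  by apply: (mulfI nm); rewrite -normM em normM norm_frob.
split=> //; rewrite e frobB !exprMn frobK.
apply: (eq_from_sub _ _ _ (m * (norm p.1 - norm x0))).
  by rewrite np subrr mulr0.
by rewrite !normE; ring.
Qed.

Lemma on_line_uniq m m' p : norm p.1 != norm x0 ->
  on_line m p -> on_line m' p -> m = m'.
Proof.
move=> np e e'; apply/eqP/negPn/negP => mm.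
by have [/eqP] := on_line_inj _ _ _ e e' mm; rewrite (negPf np).
Qed.

Lemma aligned_on_line m r s : on_line m r -> aligned 1 m r s = on_line m s.
Proof.
rewrite /aligned /on_line mul1r => /eqP e.
rewrite -subr_eq0 -[RHS]subr_eq0 -oppr_eq0; congr (_ == 0).
apply: (eq_from_sub _ _ _ ((m * r.1 - m ^+ q * x0) - (r.2 - y0))).
  by rewrite e subrr.
by ring.
Qed.

(** The condition on [m] is polynomial of degree [q] with leading coefficient [x0]. *)
Lemma card_on_line p : (#|[set m | on_line m p]| <= q)%N.
Proof.
have q1 : (1 < q)%N by rewrite -{1}(expn0 2) ltn_exp2l // ltnW.
pose P : {poly F} := x0 *: 'X^q + ((p.2 - y0)%:P - p.1 *: 'X).
have P0 : P`_q != 0.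
  rewrite !coefE eqxx mulr1 eqn0Ngt (ltnW q1) /=.
  by rewrite gtn_eqF // mulr0 subr0 addr0 x0_neq0.
apply: (@card_roots_le _ P).
- by apply: contraNneq P0 => ->; rewrite coef0.
- apply: leq_trans (size_polyD _ _) _; rewrite geq_max; apply/andP; split.
    by apply: leq_trans (size_scale_leq _ _) _; rewrite size_polyXn.
  apply: leq_trans (size_polyD _ _) _; rewrite geq_max size_polyN.
  rewrite (leq_trans (size_polyC_leq1 _)) //.
  by rewrite (leq_trans (size_scale_leq _ _)) // size_polyX ltnW.
move=> m; rewrite inE /on_line rootE => /eqP e.
rewrite /P !(hornerD, hornerN, hornerZ, hornerXn, hornerX, hornerC) e.
by apply/eqP; ring.
Qed.


(** For [p.1 != 0], the fixed points are those in the conclusion of [on_line_inj]. Projectively, the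
    line x = 0 is exchanged with the line at infinity. *)
Definition baer_involution (p : F * F) : F * F :=
  (norm x0 / p.1 ^+ q, y0 - x0 * (p.2 - y0) ^+ q / p.1 ^+ q).

Lemma on_line_baer_involution m p :
  p.1 != 0 -> on_line m p -> on_line m (baer_involution p).
Proof.
move=> p0 /eqP e; rewrite /on_line /= e frobB !exprMn frobK normE.
by apply/eqP; field; rewrite expf_neq0.
Qed.

(* The condition for the image of [p] under [baer_involution] to lie on the conic,
   with denominators cleared and raised to the power [q], is quadratic in [p]. *)
Definition conjugate_quadric (X Y : F) : F :=
  let x := X + n1 in let w := Y - (y0 - n2) in
  let A := norm x0 - n1 ^+ q * x in
  let B := (y0 - n2) ^+ q * x - x0 ^+ q * w in
  a ^+ q * A ^+ 2 + d ^+ q * A * B + b ^+ q * B ^+ 2 - x ^+ 2.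

Lemma conjugate_quadric_frob p :
  conjugate_quadric (p.1 - n1) (p.2 - n2) ^+ q =
  cform (norm x0 - n1 * p.1 ^+ q) ((y0 - n2) * p.1 ^+ q - x0 * (p.2 - y0) ^+ q)
    - (p.1 ^+ q) ^+ 2.
Proof.
rewrite /conjugate_quadric subrK.
have -> : p.2 - n2 - (y0 - n2) = p.2 - y0 by ring.
move: (y0 - n2) (p.2 - y0) => k w.
rewrite !(frobB, frobD, exprMn, frobX, frobK, frob_norm).
by rewrite /cform; ring.
Qed.

Lemma oval_conic p : p \in oval -> p.1 != n1 -> cform (p.1 - n1) (p.2 - n2) = 1.
Proof.
by rewrite inE /on_oval -(subr_eq0 p.1 n1) => + /negPf p1; rewrite p1 /= => /eqP.
Qed.

(** Points of [A] are fixed, so [conjugate_quadric] vanishes at more than four conic points, hence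
    at every conic point off the vertical line through the nucleus. *)
Lemma oval_baer_involution (A : {set F * F}) : (4 < #|A|)%N ->
  (forall p, p \in A -> [/\ p \in oval, p.1 != n1, norm p.1 = norm x0 &
    x0 * (p.2 - y0) ^+ q = - (p.1 ^+ q * (p.2 - y0))]) ->
  forall p, p \in oval -> p.1 != n1 -> p.1 != 0 /\ baer_involution p \in oval.
Proof.
move=> A4 AP.
pose A' := [set (p.1 - n1, p.2 - n2) | p in A].
have A'4 : (4 < #|A'|)%N.
  rewrite card_in_imset // => -[x y] [x' y'] _ _ /= [] /eqP + /eqP.
  by rewrite -!(subr_eq _ _ (- _)) !opprK !subrK => /eqP -> /eqP ->.
have A'P s : s \in A' ->
    [/\ s.1 != 0, cform s.1 s.2 = 1 & conjugate_quadric s.1 s.2 = 0].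
  move=> /imsetP[p pA -> /=]; have [pO p1 np wp] := AP _ pA.
  split; [by rewrite subr_eq0 | exact: oval_conic |].
  apply: frob_inj; rewrite expr0n expn_eq0 /= conjugate_quadric_frob.
  rewrite wp -np normE opprK.
  have -> : p.1 * p.1 ^+ q - n1 * p.1 ^+ q = p.1 ^+ q * (p.1 - n1) by ring.
  have -> : (y0 - n2) * p.1 ^+ q + p.1 ^+ q * (p.2 - y0) =
    p.1 ^+ q * (p.2 - n2) by ring.
  by rewrite cformZ oval_conic // mulr1 subrr.
have vanish X Y : X != 0 -> cform X Y = 1 -> conjugate_quadric X Y = 0.
  move=> X0 C.
  (* Coefficients of [conjugate_quadric] expanded in its arguments; multiples of 2 are kept so that
     [ring] proves [QE]. *)
  pose k := y0 - n2.
  pose r := k ^+ q * n1 + x0 ^+ q * k.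
  pose t := norm x0 - n1 ^+ q * n1.
  pose al := a ^+ q * (n1 ^+ q) ^+ 2 - d ^+ q * n1 ^+ q * k ^+ q +
    b ^+ q * (k ^+ q) ^+ 2 - 1.
  pose be := b ^+ q * (x0 ^+ q) ^+ 2.
  pose ga := a ^+ q * t ^+ 2 + d ^+ q * t * r + b ^+ q * r ^+ 2 - n1 ^+ 2.
  pose de := d ^+ q * n1 ^+ q * x0 ^+ q - 2%:R * b ^+ q * k ^+ q * x0 ^+ q.
  pose ep := - 2%:R * a ^+ q * t * n1 ^+ q + d ^+ q * (t * k ^+ q - n1 ^+ q * r)
    + 2%:R * b ^+ q * k ^+ q * r - 2%:R * n1.
  pose ze := - d ^+ q * t * x0 ^+ q - 2%:R * b ^+ q * x0 ^+ q * r.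
  have QE X' Y' : al * X' ^+ 2 + be * Y' ^+ 2 + ga + de * X' * Y' + ep * X' +
      ze * Y' = conjugate_quadric X' Y'.
    rewrite /conjugate_quadric /al /be /ga /de /ep /ze /t /r /k.
    move: (norm x0) (n1 ^+ q) (x0 ^+ q) ((y0 - n2) ^+ q) (a ^+ q) (b ^+ q) (d ^+ q).
    by move=> *; ring.
  rewrite -QE; apply: (conic_quadric_vanish _ a b d char2_two0 al be ga de ep ze A') => //.
  by move=> s sA; have [? ? ?] := A'P _ sA; split; rewrite ?QE.
move=> p pO p1.
have : conjugate_quadric (p.1 - n1) (p.2 - n2) ^+ q = 0.
  by rewrite vanish ?subr_eq0 ?oval_conic // expr0n expn_eq0.
rewrite conjugate_quadric_frob => /eqP; rewrite subr_eq0 => /eqP C.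
(* Otherwise [C] would give a zero of [cform] with first coordinate [norm x0]. *)
have p0 : p.1 != 0.
  apply/eqP => p0; move: C; rewrite p0 (expr0n _ q) expn_eq0 /= !mulr0 subr0 expr0n /=.
  move=> C; have [/eqP nx0 _] := aniso _ _ C.
  by move: nx0; rewrite norm_eq0; apply/negP/x0_neq0.
split=> //; rewrite inE /on_oval /=; apply/orP; right; apply/eqP.
have pq : p.1 ^+ q != 0 by rewrite expf_neq0.
have -> : norm x0 / p.1 ^+ q - n1 = (p.1 ^+ q)^-1 * (norm x0 - n1 * p.1 ^+ q).
  by field.
have -> : y0 - x0 * (p.2 - y0) ^+ q / p.1 ^+ q - n2 = (p.1 ^+ q)^-1 *
    ((y0 - n2) * p.1 ^+ q - x0 * (p.2 - y0) ^+ q) by field.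
by rewrite cformZ C exprVn mulVf // expf_neq0.
Qed.

Lemma inner_secant : exists r s m,
  [/\ r \in outer, s \in outer, r != s, on_line m r & on_line m s].
Proof.
have outer_norm p : p \in outer -> norm p.1 != norm x0.
  by rewrite in_outer => /andP[_]; apply: contraNneq => ->.
have [/exists_inP[r ro /exists_inP[s so /andP[rs /eqP e]]]|] := boolP
    [exists r in outer, exists s in outer, (r != s) && (line_slope r == line_slope s)].
  exists r, s, (line_slope r); split => //; first exact/on_line_slope/outer_norm.
  by rewrite e; apply/on_line_slope/outer_norm.
move=> /exists_inPn none.
have inj r s : r \in outer -> s \in outer -> line_slope r = line_slope s -> r = s.
  move=> ro so /eqP e; apply/eqP/negPn/negP => rs.
  by have /exists_inP[] := none _ ro; exists s => //; rewrite rs.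
pose R r s := on_line (line_slope r) s.
have mate r : r \in outer -> exists2 s, s \in inner & R r s.
  move=> ro; have rO : r \in oval by move: ro; rewrite in_outer => /andP[].
  have vw : 1 != 0 :> F \/ line_slope r != 0 by left; exact: oner_neq0.
  have [s [sO sr]] := oval_mate _ _ _ rO vw.
  have lr := on_line_slope _ (outer_norm _ ro).
  rewrite (aligned_on_line _ _ _ lr) => rs; exists s => //.
  rewrite in_inner sO; apply: contraT => sU.
  have so : s \in outer by rewrite in_outer sO.
  case/eqP: sr; apply: inj => //; apply: (on_line_uniq _ _ s) => //.
    exact: outer_norm.
  by apply: on_line_slope; apply: outer_norm.
(* By [inj], outer points may be counted by their slopes. *)
have fiber s (B : {set F * F}) : B \subset outer ->
    (#|[set r in B | R r s]| <= #|[set m | on_line m s]|)%N.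
  move=> /subsetP Bo; rewrite -(@card_in_imset _ _ line_slope).
    apply: subset_leq_card; apply/subsetP => m /imsetP[r + ->].
    by rewrite !inE => /andP[].
  move=> r r'; rewrite inE => /andP[/Bo ro _].
  by rewrite inE => /andP[/Bo r'o _]; apply: inj.
(* By [on_line_inj] these points lie in the Baer subplane. Outer points are split by whether their
   line meets one of them. *)
pose baer := [set s in inner | (1 < #|[set m | on_line m s]|)%N].
pose near := [set r in outer | [exists s in baer, R r s]].
have far_le : (#|outer :\: near| <= 1 * #|inner|)%N.
  apply: leq_trans (_ : 1 * #|inner :\: baer| <= _)%N; last first.
    by rewrite leq_mul2l subset_leq_card // subsetDl.
  apply: (@card_le_rel _ _ _ _ R) => [r|s].
    rewrite in_setD => /andP[rn ro]; have [s si rs] := mate r ro.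
    exists s => //; rewrite in_setD si andbT; apply: contra rn => sb.
    by rewrite inE ro; apply/exists_inP; exists s.
  rewrite in_setD inE negb_and => /andP[/orP[/negPf-> //|+] _]; rewrite -leqNgt.
  by apply: leq_trans; apply: fiber; exact: subsetDl.
have baerP s : s \in baer -> [/\ s \in oval, norm s.1 = norm x0 &
    x0 * (s.2 - y0) ^+ q = - (s.1 ^+ q * (s.2 - y0))].
  move=> /setIdP[]; rewrite in_inner => /andP[sO _].
  move=> /card_gt1P[m [m' [e e' mm]]]; rewrite !inE in e e'.
  by have [np wp] := on_line_inj _ _ _ e e' mm; split.
have vertical (B : {set F * F}) :
    {in B, forall p, p \in oval /\ p.1 = n1} -> (#|B| <= 2)%N.
  move=> BP; apply: leq_trans (card_oval_vertical _ _ _ _ char2_two0 aniso n1 n2 n1).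
  apply: subset_leq_card; apply/subsetP => p /BP[pO p1].
  by rewrite inE pO p1 eqxx.
have near_le : (#|near| <= 6 * q)%N.
  (* The image of [r] under the Baer involution would be a third hyperoval point
     on the line through [r] and [s] as soon as [#|A| > 4]. *)
  pose A := [set s in baer | s.1 != n1].
  have [A4|A4] := leqP #|A| 4.
    apply: (@leq_trans (q * #|baer|)).
      apply: (@card_le_rel _ _ _ _ R) => [r|s _].
        by rewrite inE => /andP[_ /exists_inP[s sb rs]]; exists s.
      apply: leq_trans (card_on_line s); apply: fiber.
      by apply/subsetP => r; rewrite inE => /andP[].
    rewrite mulnC leq_mul2r; apply/orP; right.
    (* At most 4 points come from [A] and 2 from the vertical line through the nucleus. *)
    rewrite -(cardsID [set s | s.1 != n1] baer) (_ : 6 = 4 + 2)%N //.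
    apply: leq_add; first by rewrite (_ : _ :&: _ = A) //; apply/setP => s; rewrite !inE.
    apply: vertical => s; rewrite in_setD inE negbK => /andP[/eqP sn /baerP[]].
    by split.
  apply: (@leq_trans 2); last by have := expn_gt0 2 h; lia.
  apply: vertical => r; rewrite inE => /andP[ro /exists_inP[s sb rs]].
  have rO : r \in oval by move: ro; rewrite in_outer => /andP[].
  split=> //; apply/eqP; apply: contraT => r1.
  have [|r0 irO] := oval_baer_involution A A4 _ r rO r1.
    by move=> p; rewrite inE => /andP[/baerP[]].
  have nr := outer_norm _ ro.
  have lr := on_line_slope _ nr.
  have li := on_line_baer_involution _ _ r0 lr.
  have [sO ns _] := baerP _ sb.
  have rq : r.1 ^+ q != 0 by rewrite expf_neq0.
  have ir : baer_involution r != r.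
    apply: contraNneq nr => /(congr1 fst) /= e.
    by rewrite normE -{1}e divfK.
  have sr : s != r by apply: contraNneq nr => <-; rewrite ns.
  have vw : 1 != 0 :> F \/ line_slope r != 0 by left; exact: oner_neq0.
  have ie : baer_involution r = s.
    by apply: (oval_uniq _ _ r _ _ vw) => //; rewrite aligned_on_line.
  have s0 : s.1 != 0.
    by rewrite -norm_eq0 ns norm_eq0 x0_neq0.
  (* Since [s] has the norm of [x0], being the image of [r] forces [r.1 = s.1]. *)
  case/eqP: nr; rewrite -ns; congr norm; apply: frob_inj.
  by apply: (mulfI s0); rewrite -normE ns -ie /= divfK.
(* The outer points number at most |inner| + 6q, so q^2 <= 2|inner| + 6q, against
   [card_inner_small]. *)
have := card_inner_outer; have := card_oval_ge; have := card_inner_small.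
have : (#|outer| = #|near| + #|outer :\: near|)%N.
  rewrite -(cardsID near outer); congr addn; apply: eq_card => p.
  by rewrite in_setI andbC inE -andbA andbC; case: (p \in outer); rewrite ?andbF ?andbT.
by move: far_le near_le; lia.
Qed.

End InnerPoint.

(** * Arc property and completeness *)

Lemma odot_outer (m : F) p : p \in outer -> odot q U m p.1 = m * p.1.
Proof. by rewrite in_outer /odot => /andP[_ /negPf ->]. Qed.

Definition outer_points (P : mpoint F) : Prop :=
  exists x y : F, P = Aff x y /\ (x, y) \in oval /\ norm x \notin U.

Lemma outer_points_arc : is_arc q U outer_points.
Proof.
move=> P1 P2 P3 [x1 [y1 [-> [O1 U1]]]] [x2 [y2 [-> [O2 U2]]]].
move=> [x3 [y3 [-> [O3 U3]]]] P12 P13 P23 [l].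
have r1 : (x2, y2) != (x1, y1) by apply/eqP => -[e1 e2]; rewrite e1 e2 in P12.
have r2 : (x3, y3) != (x1, y1) by apply/eqP => -[e1 e2]; rewrite e1 e2 in P13.
have collinear (v w : F) : v != 0 \/ w != 0 ->
    aligned v w (x1, y1) (x2, y2) -> aligned v w (x1, y1) (x3, y3) -> False.
  move=> vw e e'; have [e1 e2] := oval_uniq _ _ _ _ _ vw O1 O2 O3 r1 r2 e e'.
  by rewrite e1 e2 in P23.
case: l => [c|m n|] /=; last by case.
  move=> [c1 [c2 c3]]; apply: (collinear 0 1); first by right; exact: oner_neq0.
    by rewrite /aligned /= c1 c2 subrr mul0r mulr0.
  by rewrite /aligned /= c1 c3 subrr mul0r mulr0.
rewrite /odot (negPf U1) (negPf U2) (negPf U3) => -[e1 [e2 e3]].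
apply: (collinear 1 m); first by left; exact: oner_neq0.
  by rewrite /aligned /= e1 e2; apply/eqP; ring.
by rewrite /aligned /= e1 e3; apply/eqP; ring.
Qed.

Lemma outer_points_maximal P r s l :
  ~ outer_points P -> r \in outer -> s \in outer -> r != s ->
  incid q U P l -> incid q U (Aff r.1 r.2) l -> incid q U (Aff s.1 s.2) l ->
  ~ is_arc q U (fun X => outer_points X \/ X = P).
Proof.
move=> SP ro so rs lP lr ls arc.
have SO p : p \in outer -> outer_points (Aff p.1 p.2).
  rewrite in_outer => /andP[pO pU]; exists p.1, p.2.
  by rewrite -surjective_pairing.
apply: (arc P (Aff r.1 r.2) (Aff s.1 s.2)); try by [right | left; apply: SO].
- by move=> PE; apply: SP; rewrite PE; apply: SO.
- by move=> PE; apply: SP; rewrite PE; apply: SO.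
- by move=> [e1 e2]; case/eqP: rs; rewrite (surjective_pairing r) e1 e2 -surjective_pairing.
by exists l.
Qed.

Lemma outer_points_complete : is_complete_arc q U outer_points.
Proof.
split=> [|P SP]; first exact: outer_points_arc.
case: P SP => [x0 y0|m|] SP.
- have [x0U|x0U] := boolP (norm x0 \in U).
    have [r [s [m [ro so rs lr ls]]]] := inner_secant x0 y0 x0U.
    (* The intercept makes the line pass through [(x0, y0)], where the product is [m ^+ q * x0]. *)
    have on_slope p : p \in outer -> on_line x0 y0 m p ->
        incid q U (Aff p.1 p.2) (LSlope m (y0 - m ^+ q * x0)).
      move=> po /eqP e; rewrite /= odot_outer //.
      by rewrite -[LHS](subrK y0) e; ring.
    apply: (outer_points_maximal _ r s (LSlope m (y0 - m ^+ q * x0))) => //;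
      try exact: on_slope.
    by rewrite /= /odot x0U; ring.
  have [r rO|r [s [ro so rs]]] := outer_secant x0 y0 1.
    have rx : r != (x0, y0).
      by apply/eqP => rE; apply: SP; exists x0, y0; rewrite -rE.
    rewrite !mul1r; have [e1|e1] := eqVneq x0 r.1.
      right; rewrite subr_eq0; apply: contra_neq rx => e2.
      by rewrite (surjective_pairing r) e1 e2.
    by left; rewrite subr_eq0.
  rewrite /aligned !mul1r => /eqP e.
  have [rs1|rs1] := eqVneq r.1 s.1.
    have rs2 : s.2 - r.2 != 0.
      rewrite subr_eq0; apply: contra_neq rs => rs2.
      by rewrite (surjective_pairing r) rs1 -rs2 -surjective_pairing.
    apply: (outer_points_maximal _ r s (LVert r.1)) => //=.
    apply/eqP; rewrite -subr_eq0 -(mulIr_eq0 _ (mulIf rs2)) -e rs1 subrr mulr0 //.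
  have sr0 : s.1 - r.1 != 0 by rewrite subr_eq0 eq_sym.
  pose m := (s.2 - r.2) / (s.1 - r.1).
  have mE : m * (s.1 - r.1) = s.2 - r.2 by rewrite /m divfK.
  apply: (outer_points_maximal _ r s (LSlope m (r.2 - m * r.1))) => //=.
  + rewrite /odot (negPf x0U); apply/eqP; rewrite -subr_eq0.
    rewrite -(mulIr_eq0 _ (mulIf sr0)); apply/eqP.
    apply: (eq_from_sub _ _ _ ((y0 - r.2) * (s.1 - r.1) -
      (x0 - r.1) * (m * (s.1 - r.1)))); first by rewrite mE e subrr.
    by ring.
  + by rewrite odot_outer //; ring.
  by rewrite odot_outer // -[LHS](subrK r.2) -mE; ring.
- have [r rO|r [s [ro so rs]]] := outer_secant 1 m 0.
    by left; rewrite mul0r subr0 oner_neq0.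
  rewrite /aligned !mul0r !subr0 mul1r => /eqP e.
  apply: (outer_points_maximal _ r s (LSlope m (r.2 - m * r.1))) => //=.
    by rewrite odot_outer //; ring.
  by rewrite odot_outer // -[LHS](subrK r.2) -e; ring.
have [r rO|r [s [ro so rs]]] := outer_secant 0 1 0.
  by right; rewrite mul0r subr0 oner_neq0.
rewrite /aligned !mul0r !subr0 mul1r mul0r subr_eq0 => /eqP e.
by apply: (outer_points_maximal _ r s (LVert r.1)).
Qed.

End DualAndre.

(** * Normal form of a regular hyperoval, and the theorem *)

(** Polarity with the nucleus determines [e] and [f]; translating the nucleus to the origin then
    removes the linear terms, and dividing by [k] normalizes the constant. *)
Lemma regular_affine_hyperoval_oval (F : finFieldType) (Om : {set F * F}) :
  2%:R = 0 :> F -> regular_affine_hyperoval Om -> exists a b d n1 n2 : F,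
  [/\ d != 0, forall X Y, cform F a b d X Y = 0 -> X = 0 /\ Y = 0
    & Om = oval F a b d n1 n2].
Proof.
move=> two0 [a [b [c [d [e [f [[[m1 m2] m3] [nd [m0 nuc] anis /= m30 ->]]]]]]]].
have m3N0 : m3 != 0 by apply/eqP.
pose n1 := m1 / m3; pose n2 := m2 / m3.
have m1E : m1 = n1 * m3 by rewrite divfK.
have m2E : m2 = n2 * m3 by rewrite divfK.
have eE : e = d * n2.
  apply: (mulIf m3N0); apply: (eq_from_sub _ _ _
    (polar a b c d e f (m1, m2, m3) (1, 0, 0) - 2%:R * (a * m1 + d * m2))).
    by rewrite nuc two0 mul0r subrr.
  by rewrite /polar /vadd /qform /= m2E; ring.
have fE : f = d * n1.
  apply: (mulIf m3N0); apply: (eq_from_sub _ _ _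
    (polar a b c d e f (m1, m2, m3) (0, 1, 0) - 2%:R * (b * m2 + d * m1))).
    by rewrite nuc two0 mul0r subrr.
  by rewrite /polar /vadd /qform /= m1E; ring.
(* In characteristic 2 this is the value of the form at [(n1, n2, 1)], nonzero because the nucleus
   spans a radical direction of the polar form. *)
pose k := a * n1 ^+ 2 + b * n2 ^+ 2 + c + d * n1 * n2.
have k0 : k != 0.
  apply/eqP => k0; apply: (nd (m1, m2, m3) m0); split=> //.
  apply: (eq_from_sub _ _ _ (k * m3 ^+ 2 + 2%:R * (d * n1 * n2 * m3 ^+ 2))).
    by rewrite k0 two0 !mul0r addr0.
  by rewrite /qform eE fE m1E m2E /k; ring.
(* If [d = 0], the form at infinity is the square of a linear form, whose zero would be a conic
   point at infinity. *)
have dN0 : d != 0.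
  apply/eqP => d0.
  have [ra raE] := char2_sqrt _ two0 a; have [rb rbE] := char2_sqrt _ two0 b.
  have vanish x y : ra * x = rb * y -> qform a b c d e f (x, y, 0) = 0.
    move=> xy; rewrite /qform d0 -raE -rbE.
    apply: (eq_from_sub _ _ _
      ((ra * x) ^+ 2 - (rb * y) ^+ 2 + 2%:R * (rb * y) ^+ 2)).
      by rewrite xy two0 subrr mul0r addr0.
    by ring.
  have [b0|b0] := eqVneq rb 0.
    apply: (anis 0 1); first by case=> /eqP; rewrite oner_eq0.
    by apply: vanish; rewrite b0 mulr0 mul0r.
  by apply: (anis rb ra); [case=> /eqP; rewrite (negPf b0)|apply: vanish; rewrite mulrC].
exists (a / k), (b / k), (d / k), n1, n2; split.
- by rewrite mulf_neq0 ?invr_neq0.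
- move=> X Y C; have Q0 : qform a b c d e f (X, Y, 0) = 0.
    by rewrite -(mul0r k) -[in RHS]C /qform /cform; field.
  have [/eqP[-> ->] //|XY] := boolP ((X, Y) == (0, 0)).
  by case: (anis X Y) => //; apply/eqP.
apply/setP => -[x y]; rewrite !inE /on_oval /= orbC; congr orb.
  by rewrite xpair_eqE !subr_eq0.
rewrite -[LHS]/(qform a b c d e f (x, y, 1) == 0).
have -> : qform a b c d e f (x, y, 1) =
    (cform F (a / k) (b / k) (d / k) (x - n1) (y - n2) - 1) * k.
  rewrite mulrBl mul1r (_ : cform _ _ _ _ _ _ * k = cform F a b d (x - n1) (y - n2));
    last by rewrite /cform; field.
  apply: (char2_eq _ two0 _ _ (c + a * n1 * x + b * n2 * y + d * n1 * y + d * n2 * x)).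
  by rewrite /qform /cform /k eE fE; ring.
by rewrite mulf_eq0 (negPf k0) orbF subr_eq0.
Qed.

(* F = GF(q^2) with q = 2^h; GF(q) = {x | x^q = x}; Phi = {P(x,y) : ||x|| \notin U}. *)
Theorem theorem1p1 (h : nat) (F : finFieldType) (U : {set F})
    (Om : {set F * F}) :
  (1 < h)%N ->
  #|F| = ((2 ^ h) ^ 2)%N ->
  (forall u, u \in U -> u != 0 /\ u ^+ (2 ^ h)%N = u) ->
  (4 * (#|U| + 1) < 2 ^ h)%N ->
  regular_affine_hyperoval Om ->
  is_complete_arc (2 ^ h)%N U
    (fun P => exists x y : F, P = Aff x y /\ (x, y) \in Om /\
                              norm (2 ^ h)%N x \notin U).
Proof.
move=> h1 cardF UP Usmall Om_reg.
have [a [b [d [n1 [n2 [d0 aniso ->]]]]]] :=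
  regular_affine_hyperoval_oval _ _ (char2_two0 _ _ cardF) Om_reg.
exact: outer_points_complete.
Qed.
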